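(* Let $\mathcal{C}$ be a category and let $e:\mathrm{Id}_{\mathcal{C}}\to\mathrm{Id}_{\mathcal{C}}$ be an idempotent natural transformation. Then the quotient functor $H:\mathcal{C}\to\mathcal{C}_e$ is a bireflection if and only if $e$ splits (e.g. when $\mathcal{C}$ is idempotent complete).
   Context: Coidentifier: for an idempotent natural transformation $e:\mathrm{Id}_{\mathcal{C}}\to\mathrm{Id}_{\mathcal{C}}$ (i.e. $e\circ e=e$), the category $\mathcal{C}_e$ has the same objects as $\mathcal{C}$ and $\mathrm{Hom}_{\mathcal{C}_e}(A,B)=\mathrm{Hom}_{\mathcal{C}}(A,B)/\sim$, where $f\sim g$ iff $e_B\circ f=e_B\circ g$. The quotient functor $H:\mathcal{C}\to\mathcal{C}_e$ is the identity on objects and the canonical projection on morphisms. A functor $G:\mathcal{D}\to\mathcal{C}$ is a bireflection if it has a left and right adjoint equal, say $F:\mathcal{C}\to\mathcal{D}$, which is fully faithful and satisfies the coherence condition $\gamma\circ\epsilon=\mathrm{Id}_{FG}$, where $\epsilon:FG\to\mathrm{Id}_{\mathcal{D}}$ is the counit of $F\dashv G$ and $\gamma:\mathrm{Id}_{\mathcal{D}}\to FG$ is the unit of $G\dashv F$. $e$ splits if there are a functor $P:\mathcal{C}\to\mathcal{C}$ and natural transformations $\pi:\mathrm{Id}_{\mathcal{C}}\to P$, $\iota:P\to\mathrm{Id}_{\mathcal{C}}$ with $\iota\circ\pi=e$ and $\pi\circ\iota=\mathrm{Id}_P$ (equivalently, every component $e_X$ is a split idempotent). A category is idempotent complete if all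 its idempotent endomorphisms split. *)

(* Defs.v *)
From HB Require Import structures.
From mathcomp Require Import all_boot.
From mathcomp Require Import boolp.

Set Implicit Arguments.
Unset Strict Implicit.
Unset Printing Implicit Defensive.

Declare Scope cat_scope.
Delimit Scope cat_scope with cat.
Local Open Scope cat_scope.
Local Open Scope quotient_scope.

Reserved Notation "g ∘ f" (at level 40, left associativity).
Reserved Notation "g ∘F f" (at level 40, left associativity).
Reserved Notation "g ∘N f" (at level 40, left associativity).

Record category := Category {
  obj :> Type;
  hom : obj -> obj -> Type;
  idm : forall A, hom A A;
  comp : forall A B C, hom B C -> hom A B -> hom A C;
  comp1m : forall A B (f : hom A B), comp (idm B) f = f;
  compm1 : forall A B (f : hom A B), comp f (idm A) = f;
  compmA : forall A B C D (h : hom C D) (g : hom B C) (f : hom A B),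
    comp h (comp g f) = comp (comp h g) f
}.
Arguments idm {c} A.
Arguments comp {c A B C} g f : rename.

Notation "g ∘ f" := (comp g f) : cat_scope.

Record functor (C D : category) := Functor {
  fobj :> C -> D;
  fmap : forall A B : C, hom A B -> hom (fobj A) (fobj B);
  fmap1 : forall A : C, fmap (idm A) = idm (fobj A);
  fmapM : forall (A B X : C) (g : hom B X) (f : hom A B),
    fmap (g ∘ f) = fmap g ∘ fmap f
}.
Arguments fmap {C D} f {A B} _ : rename.

Definition fid (C : category) : functor C C :=
  @Functor C C id (fun A B f => f) (fun A => erefl) (fun A B X g f => erefl).

Section FunctorComposition.
Variables (C D E : category) (G : functor D E) (F : functor C D).

Fact fcomp1 (A : C) : fmap G (fmap F (idm A)) = idm (G (F A)).
Proof. by rewrite !fmap1. Qed.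

Fact fcompM (A B X : C) (g : hom B X) (f : hom A B) :
  fmap G (fmap F (g ∘ f)) = fmap G (fmap F g) ∘ fmap G (fmap F f).
Proof. by rewrite !fmapM. Qed.

Definition fcomp : functor C E :=
  @Functor C E (fun A => G (F A)) (fun A B f => fmap G (fmap F f)) fcomp1 fcompM.

End FunctorComposition.

Notation "G ∘F F" := (fcomp G F) : cat_scope.

Definition faithful (C D : category) (F : functor C D) : Prop :=
  forall A B : C, injective (@fmap _ _ F A B).

Definition full (C D : category) (F : functor C D) : Prop :=
  forall (A B : C) (g : hom (F A) (F B)), exists f : hom A B, fmap F f = g.

Definition fully_faithful (C D : category) (F : functor C D) : Prop :=
  full F /\ faithful F.

Record nat_trans (C D : category) (F G : functor C D) := NatTrans {
  component :> forall A : C, hom (F A) (G A);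
  naturality : forall (A B : C) (f : hom A B),
    component B ∘ fmap F f = fmap G f ∘ component A
}.

Lemma nat_trans_ext (C D : category) (F G : functor C D)
  (s t : nat_trans F G) : (forall A, s A = t A) -> s = t.
Proof.
case: s t => [s sP] [t tP] /= st.
have {st} : s = t by apply: functional_extensionality_dep.
by move=> st; case: _ / st tP => tP; rewrite (Prop_irrelevance sP tP).
Qed.

Section NaturalTransformations.
Variables (C D : category).

Fact ntid_natural (F : functor C D) (A B : C) (f : hom A B) :
  idm (F B) ∘ fmap F f = fmap F f ∘ idm (F A).
Proof. by rewrite comp1m compm1. Qed.

Definition ntid (F : functor C D) : nat_trans F F :=
  NatTrans (@ntid_natural F).

Fact ntcomp_natural (F G K : functor C D) (t : nat_trans G K)
    (s : nat_trans F G) (A B : C) (f : hom A B) :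
  (t B ∘ s B) ∘ fmap F f = fmap K f ∘ (t A ∘ s A).
Proof. by rewrite -compmA naturality !compmA naturality. Qed.

Definition ntcomp (F G K : functor C D) (t : nat_trans G K)
    (s : nat_trans F G) : nat_trans F K :=
  NatTrans (@ntcomp_natural F G K t s).

End NaturalTransformations.

Notation "t ∘N s" := (ntcomp t s) : cat_scope.

(* [adjunction L R] is the data witnessing L -| R *)
Record adjunction (C D : category) (L : functor C D) (R : functor D C) :=
  Adjunction {
  adj_unit : nat_trans (fid C) (R ∘F L);
  adj_counit : nat_trans (L ∘F R) (fid D);
  triangleL : forall A : C, adj_counit (L A) ∘ fmap L (adj_unit A) = idm (L A);
  triangleR : forall X : D, fmap R (adj_counit X) ∘ adj_unit (R X) = idm (R X)
}.

Definition bireflection (C D : category) (G : functor D C) : Prop :=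
  exists (F : functor C D) (FG : adjunction F G) (GF : adjunction G F),
    fully_faithful F /\ adj_unit GF ∘N adj_counit FG = ntid (F ∘F G).

Definition idempotent_nt (C : category) (e : nat_trans (fid C) (fid C)) : Prop :=
  e ∘N e = e.

Definition splits (C : category) (e : nat_trans (fid C) (fid C)) : Prop :=
  exists (P : functor C C) (p : nat_trans (fid C) P) (i : nat_trans P (fid C)),
    i ∘N p = e /\ p ∘N i = ntid P.

Definition split_idempotent (C : category) (A : C) (f : hom A A) : Prop :=
  exists (B : C) (p : hom A B) (i : hom B A), i ∘ p = f /\ p ∘ i = idm B.

Definition idempotent_complete (C : category) : Prop :=
  forall (A : C) (f : hom A A), f ∘ f = f -> split_idempotent f.

(* The hom-sets carry no choice structure, hence the passage through
   [{classic _}] to form the quotient. Idempotence of e is not needed for the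
   construction: naturality already makes the relation a congruence. *)
Section Coidentifier.
Variables (C : category) (e : nat_trans (fid C) (fid C)).

Definition coid_rel (A B : C) : rel {classic hom A B} :=
  fun f g => `[< e B ∘ f = e B ∘ g >].

Fact coid_rel_refl (A B : C) : reflexive (@coid_rel A B).
Proof. by move=> f; apply/asboolP. Qed.

Fact coid_rel_sym (A B : C) : symmetric (@coid_rel A B).
Proof. by move=> f g; apply/asboolP/asboolP => ->. Qed.

Fact coid_rel_trans (A B : C) : transitive (@coid_rel A B).
Proof. by move=> g f h /asboolP fg /asboolP gh; apply/asboolP; rewrite fg. Qed.

Canonical coid_equiv (A B : C) := EquivRel (@coid_rel A B)
  (@coid_rel_refl A B) (@coid_rel_sym A B) (@coid_rel_trans A B).

Definition coid_hom (A B : C) : Type := {eq_quot (coid_equiv A B)}.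

Definition coid_pi (A B : C) (f : hom A B) : coid_hom A B :=
  \pi_({eq_quot (coid_equiv A B)}) (f : {classic hom A B}).

Definition coid_repr (A B : C) (q : coid_hom A B) : hom A B :=
  repr (q : {eq_quot (coid_equiv A B)}).

Lemma coid_reprK (A B : C) (q : coid_hom A B) : coid_pi (coid_repr q) = q.
Proof. exact: reprK. Qed.

Lemma coid_piP (A B : C) (f g : hom A B) :
  coid_pi f = coid_pi g <-> e B ∘ f = e B ∘ g.
Proof.
by split=> [/(@eqquotP _ (coid_equiv A B))/asboolP //|fg];
  apply/(@eqquotP _ (coid_equiv A B))/asboolP.
Qed.

Definition coid_comp (A B X : C) (q : coid_hom B X) (r : coid_hom A B) :
  coid_hom A X := coid_pi (coid_repr q ∘ coid_repr r).

Lemma coid_compE (A B X : C) (g : hom B X) (f : hom A B) :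
  coid_comp (coid_pi g) (coid_pi f) = coid_pi (g ∘ f).
Proof.
have /coid_piP eg : coid_pi (coid_repr (coid_pi g)) = coid_pi g.
  exact: coid_reprK.
have /coid_piP ef : coid_pi (coid_repr (coid_pi f)) = coid_pi f.
  exact: coid_reprK.
apply/coid_piP; rewrite !compmA eg.
have eN : e X ∘ g = g ∘ e B by exact: (naturality e g).
by rewrite !eN -!compmA ef.
Qed.

Fact coid_comp1m (A B : C) (q : coid_hom A B) :
  coid_comp (coid_pi (idm B)) q = q.
Proof. by rewrite -(coid_reprK q) coid_compE comp1m. Qed.

Fact coid_compm1 (A B : C) (q : coid_hom A B) :
  coid_comp q (coid_pi (idm A)) = q.
Proof. by rewrite -(coid_reprK q) coid_compE compm1. Qed.

Fact coid_compmA (A B X Y : C) (q : coid_hom X Y) (r : coid_hom B X)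
    (s : coid_hom A B) :
  coid_comp q (coid_comp r s) = coid_comp (coid_comp q r) s.
Proof.
by rewrite -(coid_reprK q) -(coid_reprK r) -(coid_reprK s) !coid_compE compmA.
Qed.

Definition coidentifier : category :=
  @Category C coid_hom (fun A => coid_pi (idm A)) coid_comp
    coid_comp1m coid_compm1 coid_compmA.

Definition quotient_functor : functor C coidentifier :=
  @Functor C coidentifier id (fun A B f => coid_pi f) (fun A => erefl)
    (fun A B X g f => esym (coid_compE g f)).

End Coidentifier.

(* Main.v *)
(* If H is a bireflection, the unit gamma of H -| F and the counit epsilon of
   F -| H give a split idempotent e' = epsilon gamma on every object.  Since
   H e = 1, naturality gives gamma e = gamma, so e' e = e'; since H gamma is a
   split monomorphism and gamma e' = gamma, also H e' = 1, i.e. e e' = e.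
   Hence e' = e.  Conversely, a splitting (P, p, i) of e satisfies
   P f = p f i, so P factors through C_e as a fully faithful functor, and p, i
   (and their classes) are the units and counits of both adjunctions. *)
From mathcomp Require Import all_boot boolp.
Require Import Defs.

Set Implicit Arguments.
Unset Strict Implicit.
Unset Printing Implicit Defensive.

Local Open Scope cat_scope.

Lemma ntcompE (C D : category) (F G K : functor C D) (t : nat_trans G K)
    (s : nat_trans F G) (u : nat_trans F K) :
  t ∘N s = u -> forall A, t A ∘ s A = u A.
Proof. by move=> <-. Qed.

Section Coidentifier.
Variables (C : category) (e : nat_trans (fid C) (fid C)).
Hypothesis he : idempotent_nt e.

Lemma nat_fid (A B : C) (f : hom A B) : e B ∘ f = f ∘ e A.
Proof. exact: (naturality e f). Qed.

Lemma coid_pi_idem (A : C) : coid_pi e (e A) = coid_pi e (idm A).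
Proof. by apply/coid_piP; rewrite compm1 (ntcompE he). Qed.

Lemma bireflection_splits : bireflection (quotient_functor e) -> splits e.
Proof.
move=> [F [FG [GF [_ coh]]]].
pose gam := adj_unit GF; pose eps := adj_counit FG.
exists (F ∘F quotient_functor e), gam, eps; split; last exact: coh.
have ge A : gam A ∘ eps A = idm (F A) := ntcompE coh A.
apply: nat_trans_ext => A /=.
have gam_e : gam A ∘ e A = gam A.
  have /= := naturality gam (e A).
  by rewrite coid_pi_idem (fmap1 F (A : coidentifier e)) comp1m.
have H1 : coid_pi e (eps A ∘ gam A) = coid_pi e (idm A).
  have /= tri := triangleL GF A.
  set r := coid_pi e (eps A ∘ gam A).
  (* The triangle identity inserts the retraction of [H gam] in front of [r]; then [gam ∘ eps = 1]
     collapses [gam ∘ eps ∘ gam] to [gam], leaving the same identity. *)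
  rewrite -[LHS](@comp1m (coidentifier e)) -[idm _]tri.
  rewrite -(@compmA (coidentifier e)) /= coid_compE.
  by rewrite compmA ge comp1m.
(* Equality of classes reads [e ∘ (eps ∘ gam) = e]; centrality moves [e] to the right, where [gam]
   absorbs it. *)
move/coid_piP: H1; rewrite compm1 => <-.
by rewrite nat_fid -compmA gam_e.
Qed.

Section Splitting.
Variables (P : functor C C).
Variables (p : nat_trans (fid C) P) (i : nat_trans P (fid C)).
Hypotheses (ip : i ∘N p = e) (pi1 : p ∘N i = ntid P).

Let ipE A : i A ∘ p A = e A := ntcompE ip A.
Let piE A : p A ∘ i A = idm (P A) := ntcompE pi1 A.
Let pN A B (f : hom A B) : p B ∘ f = fmap P f ∘ p A := naturality p f.
Let iN A B (f : hom A B) : i B ∘ fmap P f = f ∘ i A := naturality i f.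

Lemma splitting_fmapE (A B : C) (f : hom A B) : fmap P f = p B ∘ f ∘ i A.
Proof. by rewrite pN -compmA piE compm1. Qed.

(** Both sides amount to [p B ∘ f = p B ∘ g]. Leftward, [P] descends to the quotient; rightward, the
    descended functor is faithful. *)
Lemma splitting_fmap_eq (A B : C) (f g : hom A B) :
  fmap P f = fmap P g <-> coid_pi e f = coid_pi e g.
Proof.
split=> [fg|/coid_piP fg].
  by apply/coid_piP; rewrite -!ipE -!compmA !pN fg.
(* [p = p ∘ i ∘ p = p ∘ e], so [p ∘ h] depends only on the class of [h]. *)
have pE h : p B ∘ h = p B ∘ (e B ∘ h).
  by rewrite -ipE !compmA piE comp1m.
by rewrite !splitting_fmapE pE fg -pE.
Qed.

Definition factor_fmap (A B : C) (q : coid_hom e A B) : hom (P A) (P B) :=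
  fmap P (coid_repr q).

Lemma factor_fmapE (A B : C) (f : hom A B) :
  factor_fmap (coid_pi e f) = fmap P f.
Proof. by apply/splitting_fmap_eq; rewrite coid_reprK. Qed.

Fact factor_fmap1 (A : C) : factor_fmap (coid_pi e (idm A)) = idm (P A).
Proof. by rewrite factor_fmapE fmap1. Qed.

Fact factor_fmapM (A B X : C) (r : coid_hom e B X) (q : coid_hom e A B) :
  factor_fmap (coid_comp r q) = factor_fmap r ∘ factor_fmap q.
Proof.
by rewrite -(coid_reprK r) -(coid_reprK q) coid_compE !factor_fmapE fmapM.
Qed.

Definition factor : functor (coidentifier e) C :=
  @Functor (coidentifier e) C P factor_fmap factor_fmap1 factor_fmapM.

Lemma factor_fully_faithful : fully_faithful factor.
Proof.
split=> [A B g|A B q r].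
  (* Since [p ∘ i = 1], the map [f ↦ p ∘ f ∘ i] sends [i ∘ g ∘ p] back to [g]. *)
  exists (coid_pi e (i B ∘ g ∘ p A)).
  by rewrite /= factor_fmapE splitting_fmapE !compmA piE comp1m -compmA piE compm1.
rewrite -(coid_reprK q) -(coid_reprK r) /= !factor_fmapE.
exact: (splitting_fmap_eq _ _).1.
Qed.

Let H := quotient_functor e.

Fact factor_p_natural (A B : C) (f : hom A B) :
  p B ∘ f = fmap (factor ∘F H) f ∘ p A.
Proof. by rewrite /= factor_fmapE pN. Qed.

Fact factor_i_natural (A B : C) (f : hom A B) :
  i B ∘ fmap (factor ∘F H) f = f ∘ i A.
Proof. by rewrite /= factor_fmapE iN. Qed.

Fact coid_p_natural (A B : coidentifier e) (q : hom A B) :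
  fmap H (p B) ∘ q = fmap (H ∘F factor) q ∘ fmap H (p A).
Proof.
by rewrite -(coid_reprK q) /= !coid_compE factor_fmapE pN.
Qed.

Fact coid_i_natural (A B : coidentifier e) (q : hom A B) :
  fmap H (i B) ∘ fmap (H ∘F factor) q = q ∘ fmap H (i A).
Proof.
by rewrite -(coid_reprK q) /= !coid_compE factor_fmapE iN.
Qed.

(** [factor ∘F H] agrees with [P] on objects by conversion, but on morphisms only through
    [factor_fmapE], so [p] and [i] are repackaged with new naturality proofs. *)
Definition factor_p : nat_trans (fid C) (factor ∘F H) :=
  @NatTrans C C (fid C) (factor ∘F H) p factor_p_natural.
Definition factor_i : nat_trans (factor ∘F H) (fid C) :=
  @NatTrans C C (factor ∘F H) (fid C) i factor_i_natural.
Definition coid_p : nat_trans (fid (coidentifier e)) (H ∘F factor) :=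
  @NatTrans _ _ (fid (coidentifier e)) (H ∘F factor)
    (fun A => fmap H (p A)) coid_p_natural.
Definition coid_i : nat_trans (H ∘F factor) (fid (coidentifier e)) :=
  @NatTrans _ _ (H ∘F factor) (fid (coidentifier e))
    (fun A => fmap H (i A)) coid_i_natural.

(** [i ∘ p = e] becomes an identity in the quotient; this is one triangle of each of the two
    adjunctions. *)
Fact coid_ip (A : C) : fmap H (i A) ∘ fmap H (p A) = idm (H A).
Proof. by rewrite -fmapM ipE /= coid_pi_idem. Qed.

(** Naturality of [i] at [p A] turns the composite into [p A ∘ i A]; the next triangle is dual, by
    naturality of [p] at [i A]. *)
Fact factor_i_triangle (A : C) :
  i (P A) ∘ factor_fmap (coid_pi e (p A)) = idm (P A).
Proof. by rewrite factor_fmapE iN piE. Qed.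

Fact factor_p_triangle (A : C) :
  factor_fmap (coid_pi e (i A)) ∘ p (P A) = idm (P A).
Proof. by rewrite factor_fmapE -pN piE. Qed.

Definition factor_left_adjoint : adjunction factor H :=
  @Adjunction _ _ factor H coid_p factor_i factor_i_triangle coid_ip.
Definition factor_right_adjoint : adjunction H factor :=
  @Adjunction _ _ H factor factor_p coid_i coid_ip factor_p_triangle.

Lemma splitting_bireflection : bireflection H.
Proof.
exists factor, factor_left_adjoint, factor_right_adjoint.
split; first exact: factor_fully_faithful.
by apply: nat_trans_ext => A; apply: piE.
Qed.

End Splitting.

(** Splittings chosen independently at each object still assemble: [P f] must be [p ∘ f ∘ i], and
    naturality of [e] supplies functoriality and the naturality of [p] and [i]. *)
Lemma splits_componentwise :
  (forall A : C, split_idempotent (e A)) -> splits e.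
Proof.
move=> he_split.
have splitting A : {B : C & {p : hom A B & {i : hom B A |
    i ∘ p = e A /\ p ∘ i = idm B}}}.
  by have [B /cid[p /cid ?]] := cid (he_split A); exists B, p.
have /all_tag[P /all_tag[p /all_sig[i ip]]] := splitting.
have pe A : p A ∘ e A = p A.
  by case: (ip A) => <- pi1; rewrite compmA pi1 comp1m.
have ei A : e A ∘ i A = i A.
  by case: (ip A) => <- pi1; rewrite -compmA pi1 compm1.
have P1 A : p A ∘ idm A ∘ i A = idm (P A) by rewrite compm1 (ip A).2.
have PM A B X (g : hom B X) (f : hom A B) :
    p X ∘ (g ∘ f) ∘ i A = (p X ∘ g ∘ i B) ∘ (p B ∘ f ∘ i A).
  (* The inner [i B ∘ p B] is [e B], which slides past [g] and is absorbed by [p X]. *)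
  rewrite !compmA -[p X ∘ g ∘ i B ∘ p B]compmA (ip B).1.
  by rewrite -[p X ∘ g ∘ e B]compmA -nat_fid !compmA pe.
pose F := @Functor C C P (fun A B f => p B ∘ f ∘ i A) P1 PM.
have pN A B (f : hom A B) : p B ∘ f = fmap F f ∘ p A.
  by rewrite /= -[RHS]compmA (ip A).1 -compmA -nat_fid compmA pe.
have iN A B (f : hom A B) : i B ∘ fmap F f = f ∘ i A.
  by rewrite /= !compmA (ip B).1 nat_fid -compmA ei.
exists F, (@NatTrans C C (fid C) F p pN), (@NatTrans C C F (fid C) i iN).
by split; apply: nat_trans_ext => A; case: (ip A).
Qed.

End Coidentifier.

Theorem proposition2p27 (C : category) (e : nat_trans (fid C) (fid C))
  (he : idempotent_nt e) :
  (bireflection (quotient_functor e) <-> splits e) /\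
  (idempotent_complete C -> splits e).
Proof.
split.
  split; first exact: bireflection_splits.
  by move=> [P [p [i [ip pi1]]]]; apply: splitting_bireflection ip pi1.
move=> complC; apply: splits_componentwise => A; apply: complC.
exact: (ntcompE he A).
Qed.
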